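(* Let $\ell\in(0,1]$, $\alpha\in(0,1]$, $\sigma=\sqrt\ell$, $\ell_\alpha=1-\alpha+\alpha\ell$, $s_\alpha=(1-\alpha+\alpha\sigma)^2$, $\eta=4\alpha(1-\alpha)\sigma/s_\alpha$, and let $R_m=c_{m,m+1}/\alpha$ with $c_{m,n}$ as defined in the context. For all integers $m\ge0$ we have $R_m\le\ell_\alpha^{\,m}$. Moreover, for all $\alpha\in(0,1)$ and $m\ge 0$ we have the following three alternative upper bounds (the last one interpreted as $\infty$ if $\ell=1$): $$R_m\le(1-\ell)\,\ell_\alpha^{\,m}+\sigma\;{}_2F_1\!\left(\tfrac12,-m;2;\eta\right)s_\alpha^{\,m},$$ $$R_m\le(1-\ell)\,\ell_\alpha^{\,m}+\frac{2\sigma}{\sqrt{\pi\eta}}\,\frac{\Gamma(m+1)}{\Gamma(m+3/2)}\,s_\alpha^{\,m},$$ $$R_m\le(1-\ell)\,\ell_\alpha^{\,m}+\frac{4\ell}{\sqrt{\pi}\,\eta^{3/2}(1-\sigma)^2}\,\frac{\Gamma(m+1)}{\Gamma(m+5/2)}\,s_\alpha^{\,m}.$$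
   Context: For integers $0\le m\le n$, $$c_{m,n}=\alpha\sum_{j=0}^{n-1}\sum_{k=0}^{m}\left[\binom{m}{k}\binom{n-1-j}{k}-\binom{n}{k}\binom{m-1-j}{k}\right](\alpha^2\ell)^k(1-\alpha)^{n+m-1-j-2k},$$ with the convention $\binom{a}{k}=0$ unless $0\le k\le a$, and $0^0=1$; the inner sum is restricted to $k\le\min\{m,n-1-j\}$ (the bracket vanishes for larger $k$). ${}_2F_1(a,b;c;z)=\sum_{k\ge0}\frac{(a)_k(b)_k}{(c)_k}\frac{z^k}{k!}$ with $(x)_k=\prod_{i=0}^{k-1}(x+i)$ is Gauss's hypergeometric function (here a finite sum), and $\Gamma$ is the Gamma function. *)

(* Defs.v *)
From mathcomp Require Import all_boot all_order all_algebra.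
From mathcomp Require Import all_classical all_reals all_analysis.

Set Implicit Arguments.
Unset Strict Implicit.
Unset Printing Implicit Defensive.

Import Order.TTheory GRing.Theory Num.Theory.
Import numFieldNormedType.Exports.

Local Open Scope classical_set_scope.
Local Open Scope ring_scope.

(* The top argument is an integer because m - 1 - j may be negative, in which
   case the coefficient is 0; truncated subtraction would give 'C(0, 0) = 1. *)
Definition binz (a : int) (k : nat) : nat :=
  if a is Posz n then 'C(n, k) else 0%N.

(* The bounds j < n and k <= minn m (n - 1 - j) make every truncated
   subtraction on nat below exact; x ^+ 0 = 1 also for x = 0. *)
Definition coef (R : realType) (ell alpha : R) (m n : nat) : R :=
  alpha * \sum_(0 <= j < n) \sum_(0 <= k < (minn m (n - 1 - j)).+1)
    (('C(m, k) * binz (n%:Z - 1 - j%:Z) k)%:R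
       - ('C(n, k) * binz (m%:Z - 1 - j%:Z) k)%:R)
    * (alpha ^+ 2 * ell) ^+ k * (1 - alpha) ^+ (n + m - 1 - j - 2 * k).

Definition pochhammer (R : realType) (x : R) (k : nat) : R :=
  \prod_(0 <= i < k) (x + i%:R).

Definition hyp2F1 (R : realType) (a b c z : R) : R :=
  limn (series (fun k => pochhammer a k * pochhammer b k / pochhammer c k
                           * (z ^+ k / k`!%:R))).

(* Euler's integral, meant for x > 0, where the integral is finite. *)
Definition Gamma (R : realType) (x : R) : R :=
  \int[lebesgue_measure]_(t in `]0, +oo[) (t `^ (x - 1) * expR (- t)).

(* Main.v *)
(** With [sigma = sqrt ell], [beta = 1 - alpha] and [A, B = beta + alpha sigma z^(+-1)],
    the inner sums of [coef] are constant terms of [A^m B^i].  Summing over [i] gives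
    a recursion whose solution is
      [R_m = (1 - ell) ell_alpha^m + ell * sum_k sigma^k p_k],
    where [p_k] is the [(0, k)] entry of the [m]-th power of the Jacobi matrix [J] with
    diagonal [beta^2 + (alpha sigma)^2] and off-diagonal [alpha beta sigma].  The entries
    are nonnegative and [p_k / (k + 1)] decreases in [k], so the sum is at most
    [(sum_k p_k) / sigma] and, for [sigma < 1], at most [p_0 / (1 - sigma)^2].  Writing
    [J = s_alpha - alpha beta sigma T] with [T] the discrete Laplacian turns [sum_k p_k]
    and [p_0] into the Catalan sums [s_alpha^m F(1/2, -m; 2; eta)] and
    [s_alpha^m F(3/2, -m; 3; eta)].  Finally [eta^b F(b, -m; c; eta)] is nondecreasing
    on [[0, 1]], hence at most its Chu-Vandermonde value at [eta = 1], which is compared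
    with the Gamma quotient by a Wallis inequality.  The latter is the log-convexity
    [Gamma(m + 3/2)^2 <= Gamma(m + 1) Gamma(m + 2)]. *)
Require Import Defs.
From mathcomp Require Import all_boot all_order all_algebra.
From mathcomp Require Import all_classical all_reals all_analysis.
From mathcomp Require Import measurable_realfun.
From mathcomp Require Import ring lra.

Import Order.TTheory GRing.Theory Num.Theory.
Import numFieldNormedType.Exports.

Local Open Scope ring_scope.

(** * The Gamma function at integers and half-integers *)

Section GammaValues.
Local Open Scope classical_set_scope.

(** Monotone convergence. The endpoints [u] stay free because they are [k] in the integrations by
    parts and [k ^+ 2] after the substitution in [Gamma_half]. *)
Lemma ge0_cvg_integral_itv0y (R : realType) (f : R -> R) (u : R^nat) :
  continuous f -> (forall x, 0 <= x -> 0 <= f x) ->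
  nondecreasing_seq u -> u n @[n --> \oo] --> +oo ->
  (\int[lebesgue_measure]_(x in `[0%R, u n]) (f x)%:E @[n --> \oo]
    --> \int[lebesgue_measure]_(x in `[0%R, +oo[) (f x)%:E)%E.
Proof.
move=> cf f0 ndu uy.
have -> : `[0%R, +oo[%classic = \bigcup_n `[0, u n]%classic :> set R.
  apply/seteqP; split => x /=; rewrite in_itv/= ?andbT; last first.
    by case=> n _ /=; rewrite in_itv/= => /andP[].
  move=> x0; have /cvgryPge/(_ x)[N _ /(_ N (leqnn N)) xu] := uy.
  by exists N => //=; rewrite in_itv/= x0 xu.
have := @ge0_nondecreasing_set_cvg_integral _ (measurableTypeR R) R
  (fun n => `[0, u n]%classic) (EFin \o f) lebesgue_measure.
apply.
- move=> m n mn; rewrite subsetEset => x /=; rewrite !in_itv/= => /andP[-> xm].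
  exact: le_trans xm (ndu _ _ mn).
- by move=> i; exact: measurable_itv.
- move=> i; apply/measurable_EFinP; apply: measurable_funTS.
  exact: continuous_measurable_fun.
- by move=> i x /=; rewrite in_itv/= lee_fin => /andP[/f0].
Qed.

(** * Moments of the Gaussian on the half-line *)

Definition gauss_moment (R : realType) (n : nat) (y : R) : R :=
  y ^+ n * expR (- y ^+ 2).

Lemma gauss_moment_ge0 (R : realType) n (y : R) : 0 <= y -> 0 <= gauss_moment R n y.
Proof. by move=> y0; rewrite mulr_ge0 ?exprn_ge0 ?expR_ge0. Qed.

Lemma continuous_gauss_moment (R : realType) n : continuous (gauss_moment R n).
Proof.
move=> x; apply: (@continuousM R R (fun y : R => y ^+ n) (@gauss_fun R) x).
  exact: exprn_continuous.
exact: continuous_gauss_fun.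
Qed.

Lemma is_derive_gauss_fun (R : realType) (y : R) :
  is_derive y 1 (@gauss_fun R) (- 2 * y * gauss_fun y).
Proof.
have -> : @gauss_fun R = expR \o (- (@idfun R ^+ 2)).
  by apply/funext => z; rewrite /= !fctE.
apply: is_derive_eq.
rewrite !fctE /GRing.scale/= expr1; ring.
Qed.

Lemma is_derive_gauss_moment (R : realType) n (y : R) :
  is_derive y 1 (gauss_moment R n.+1)
    (n.+1%:R * gauss_moment R n y - 2 * gauss_moment R n.+2 y).
Proof.
have ? := is_derive_gauss_fun R y.
have -> : gauss_moment R n.+1 = @idfun R ^+ n.+1 * @gauss_fun R.
  by apply/funext => z; rewrite /= !fctE.
apply: is_derive_eq.
rewrite /GRing.scale/= !fctE /gauss_moment /gauss_fun -/(idfun y) /= !exprS; ring.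
Qed.

(** Since k^(n+1) / (n+1)! is at most exp(k), hence at most exp(k^2) for k >= 1, the value at [k] is
    squeezed below (n+1)! / k. *)
Lemma cvg_gauss_moment (R : realType) n :
  gauss_moment R n k%:R @[k --> \oo] --> (0 : R).
Proof.
have c0 : (n.+1`!)%:R / k%:R @[k --> \oo] --> (0 : R).
  rewrite -[X in _ --> X](mulr0 (n.+1`!)%:R); apply: cvgMr.
  apply/gtr0_cvgV0; last exact: cvgr_idn.
  by near=> k; rewrite ltr0n; near: k; exists 1%N.
apply: (squeeze_cvgr _ (cvg_cst _) c0); near=> k.
have k0 : (0 < k)%N by near: k; exists 1%N.
have k0' : 0 < k%:R :> R by rewrite ltr0n.
rewrite gauss_moment_ge0 ?ler0n//= ler_pdivlMr// /gauss_moment.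
rewrite mulrAC -exprSr -ler_pdivlMr ?expR_gt0// -expRN opprK.
rewrite mulrC -ler_pdivrMr ?ltr0n ?fact_gt0//.
apply: (@le_trans _ _ (expR k%:R)).
  by apply: le_trans (expR_ge1Dxn n (ltW k0')); rewrite lerDr.
by rewrite ler_expR -natrX ler_nat -{1}(expn1 k) leq_pexp2l.
Unshelve. all: by end_near. Qed.

(** The fundamental theorem on bounded intervals, followed by monotone convergence. Writing the
    derivative as a difference of nonnegative functions lets each integral converge separately,
    without assuming integrability on the half-line. *)
Lemma ge0_integral_by_derivative_itv0y (R : realType) (f g F : R -> R) :
  continuous f -> continuous g ->
  (forall x, 0 <= x -> 0 <= f x) -> (forall x, 0 <= x -> 0 <= g x) ->
  (forall x : R, is_derive x 1 F (f x - g x)) -> F k%:R @[k --> \oo] --> (0 : R) ->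
  (\int[lebesgue_measure]_(x in `[0%R, +oo[) (f x)%:E =
   \int[lebesgue_measure]_(x in `[0%R, +oo[) (g x)%:E - (F 0)%:E)%E.
Proof.
move=> cf cg f0 g0 dF F0.
have nd : nondecreasing_seq (fun k => k%:R : R) by move=> m n; rewrite ler_nat.
have int h : continuous h -> forall k : nat,
    lebesgue_measure.-integrable `[0%R, k%:R] (EFin \o (h : R -> R)).
  move=> ch k; apply: continuous_compact_integrable; first exact: segment_compact.
  exact: continuous_subspaceT.
have cF : continuous F.
  by move=> x; apply/differentiable_continuous/derivable1_diffP; case: (dF x).
(* The index [k.+1] keeps the interval nondegenerate, as the fundamental theorem requires. *)
have E k : (\int[lebesgue_measure]_(x in `[0%R, k.+1%:R]) (f x)%:E =
    \int[lebesgue_measure]_(x in `[0%R, k.+1%:R]) (g x)%:E +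
    (F k.+1%:R - F 0)%:E)%E.
  rewrite EFinD EFinN -(@continuous_FTC2 _ (f \- g) F) ?ltr0n//.
  - rewrite -integralD//=; [|exact: int..|].
      by apply: eq_integral => x _; rewrite -EFinD addrC subrK.
    by apply: (int (f \- g)) => x; apply: continuousB; [exact: cf|exact: cg].
  - by apply: continuous_subspaceT => x; apply: continuousB; [exact: cf|exact: cg].
  - split=> [x _||]; first by case: (dF x).
      exact/cvg_at_right_filter/cF.
    exact/cvg_at_left_filter/cF.
  - by move=> x _; rewrite derive1E; case: (dF x).
have := ge0_cvg_integral_itv0y R f _ cf f0 nd (@cvgr_idn R).
rewrite -cvg_shiftS/= (eq_cvg _ _ E) => /(cvg_unique (@ereal_hausdorff R)); apply.
apply: cvgeD.
- by rewrite fin_num_adde_defl.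
- have := ge0_cvg_integral_itv0y R g _ cg g0 nd (@cvgr_idn R).
  by rewrite -cvg_shiftS.
- apply: cvg_EFin; first by near=> k.
  rewrite /= -[X in _ --> X]sub0r; apply: cvgB; last exact: cvg_cst.
  by move: F0; rewrite -cvg_shiftS.
Unshelve. all: by end_near. Qed.

Lemma integral_gauss_moment_rec (R : realType) n :
  (\int[lebesgue_measure]_(y in `[0%R, +oo[) (gauss_moment R n.+2 y)%:E =
   (n.+1%:R / 2)%:E * \int[lebesgue_measure]_(y in `[0%R, +oo[) (gauss_moment R n y)%:E)%E.
Proof.
have c := continuous_gauss_moment R; have g0 := gauss_moment_ge0 R.
(* Integration by parts: this primitive vanishes at 0 and at infinity. *)
pose F y := - 2^-1 * gauss_moment R n.+1 y.
have dF (x : R) : is_derive x (1 : R) F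
    (gauss_moment R n.+2 x - n.+1%:R / 2 * gauss_moment R n x).
  have ? := is_derive_gauss_moment R n x.
  have -> : F = - 2^-1 \*: gauss_moment R n.+1 by [].
  by apply: is_derive_eq; rewrite /GRing.scale/=; field.
rewrite (ge0_integral_by_derivative_itv0y _ _ _ _ _ _ _ _ dF) //.
- rewrite /F {2}/gauss_moment expr0n/= mul0r mulr0 sube0.
  under eq_integral do rewrite EFinM.
  rewrite ge0_integralZl//.
  - apply/measurable_EFinP; apply: measurable_funTS.
    by apply: continuous_measurable_fun; exact: c.
  - by move=> y /=; rewrite in_itv/= andbT lee_fin => /g0.
- move=> x; apply: (@continuousM R R (cst _) (gauss_moment R n) x).
    exact: cst_continuous.
  exact: c.
- by move=> x; exact: g0.
- by move=> x x0; rewrite mulr_ge0 ?g0.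
- rewrite -[X in _ --> X](mulr0 (- 2^-1)); apply: cvgMr.
  exact: cvg_gauss_moment.
Qed.

Lemma integral_gauss_moment1 (R : realType) :
  (\int[lebesgue_measure]_(y in `[0%R, +oo[) (gauss_moment R 1 y)%:E = (2^-1)%:E)%E.
Proof.
have c := continuous_gauss_moment R; have g0 := gauss_moment_ge0 R.
pose F y := - 2^-1 * gauss_moment R 0 y.
have dF (x : R) : is_derive x (1 : R) F (gauss_moment R 1 x - 0).
  have ? := is_derive_gauss_fun R x.
  have -> : F = - 2^-1 \*: @gauss_fun R.
    by apply/funext => y; rewrite /F /gauss_moment expr0 mul1r.
  by apply: is_derive_eq; rewrite /GRing.scale/= /gauss_moment /gauss_fun expr1; field.
rewrite (ge0_integral_by_derivative_itv0y _ _ (fun=> 0) _ _ _ _ _ dF) //.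
- rewrite integral0 /F /gauss_moment expr0 mul1r expr0n/= oppr0 expR0 mulr1 -EFinB.
  by rewrite sub0r opprK.
- exact: cst_continuous.
- by move=> x; exact: g0.
- rewrite -[X in _ --> X](mulr0 (- 2^-1)); apply: cvgMr.
  exact: cvg_gauss_moment.
Qed.

Lemma integral_gauss_moment_odd (R : realType) n :
  (\int[lebesgue_measure]_(y in `[0%R, +oo[) (gauss_moment R n.*2.+1 y)%:E = (n`!%:R / 2)%:E)%E.
Proof.
elim: n => [|n IH]; first by rewrite integral_gauss_moment1 fact0 mul1r.
rewrite doubleS integral_gauss_moment_rec IH -EFinM -doubleS -muln2 factS !natrM.
by congr EFin; field.
Qed.

(** The recursion multiplies by (2n + 1) / 2 = 1/2 + n, the next Pochhammer factor, starting from
    the Gaussian integral. *)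
Lemma integral_gauss_moment_even (R : realType) n :
  (\int[lebesgue_measure]_(y in `[0%R, +oo[) (gauss_moment R n.*2 y)%:E =
   (pochhammer (1 / 2) n * (Num.sqrt pi / 2))%:E)%E.
Proof.
elim: n => [|n IH].
  rewrite /pochhammer big_geq// mul1r -integral0y_gauss.
  by apply: eq_integral => y _; rewrite /gauss_moment expr0 mul1r.
rewrite doubleS integral_gauss_moment_rec IH -EFinM /pochhammer big_nat_recr//=.
by congr EFin; rewrite -addn1 -muln2 natrD natrM; field.
Qed.

Lemma fin_num_integral_gauss_moment (R : realType) n :
  (\int[lebesgue_measure]_(y in `[0%R, +oo[) (gauss_moment R n y)%:E)%E \is a fin_num.
Proof.
rewrite -(odd_double_half n); case: (odd n).
  by rewrite add1n integral_gauss_moment_odd.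
by rewrite add0n integral_gauss_moment_even.
Qed.

(* The substitution [t = y ^ 2] turns the half-integer powers of Euler's integral into
   natural ones. *)
Lemma Gamma_half (R : realType) n :
  Gamma (n%:R / 2 + 1) = 2 * \int[lebesgue_measure]_(y in `[0, +oo[) gauss_moment R n.+1 y.
Proof.
(* The square root replaces the real power t^(n/2) by a function continuous and nonnegative on the
   whole line. *)
pose G (t : R) := Num.sqrt t ^+ n * expR (- t).
have cG : continuous G.
  move=> x; apply: (@continuousM R R (fun t => Num.sqrt t ^+ n) (fun t => expR (- t)) x).
    apply: (@continuous_comp _ _ _ Num.sqrt (fun y => y ^+ n)).
      exact: sqrt_continuous.
    exact: exprn_continuous.
  by apply: continuous_comp; [exact: opp_continuous|exact: continuous_expR].
have G0 x : 0 <= G x by rewrite mulr_ge0 ?exprn_ge0 ?sqrtr_ge0 ?expR_ge0.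
have c := continuous_gauss_moment R.
have dsq (x : R) : is_derive x (1 : R) (@idfun R ^+ 2) (2 * x).
  by apply: is_derive_eq; rewrite /GRing.scale/= expr1 mulr1.
have sqE : (@idfun R ^+ 2)^`() = (fun x => 2 * x).
  by apply/funext => x; rewrite derive1E; case: (dsq x).
(* The substitution is made on compact intervals; [F0] below passes to the limit on both sides. *)
have E k : (\int[lebesgue_measure]_(x in `[0%R, (k%:R ^+ 2)%R]) (G x)%:E =
   2%:E * \int[lebesgue_measure]_(x in `[0%R, k%:R]) (gauss_moment R n.+1 x)%:E)%E.
  have c2 : continuous (fun x : R => 2 * x).
    move=> x; apply: (@continuousM R R (cst 2) idfun x); first exact: cst_continuous.
    exact: cvg_id.
  have := @integration_by_substitution_increasing R (@idfun R ^+ 2) G 0 k%:R.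
  rewrite !fctE /= expr0n /= sqE => ->.
  - transitivity (\int[lebesgue_measure]_(x in `[0%R, k%:R]) (2%:E * (gauss_moment R n.+1 x)%:E))%E.
      apply: eq_integral => x; rewrite inE/= in_itv/= => /andP[x0 _].
      by rewrite -EFinM /G /gauss_moment sqrtr_sqr ger0_norm// (exprS _ n); congr EFin; ring.
    rewrite ge0_integralZl//.
    + apply/measurable_EFinP; apply: measurable_funTS.
      by apply: continuous_measurable_fun; exact: c.
    + by move=> y /=; rewrite in_itv/= lee_fin => /andP[/gauss_moment_ge0].
  - exact: ler0n.
  - by move=> x y; rewrite !in_itv/= => /andP[x0 _] /andP[y0 _] xy; rewrite ltrXn2r.
  - by move=> x _; exact: c2.
  - by apply/cvg_ex; exists (2 * 0); apply: cvg_at_right_filter; exact: c2.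
  - by apply/cvg_ex; exists (2 * k%:R); apply: cvg_at_left_filter; exact: c2.
  - split=> [x _||]; first by case: (dsq x).
      apply: cvg_at_right_filter; exact: exprn_continuous.
    apply: cvg_at_left_filter; exact: exprn_continuous.
  - exact: continuous_subspaceT.
rewrite /Gamma /Rintegral.
transitivity (fine (\int[lebesgue_measure]_(t in `[0%R, +oo[) (G t)%:E)%E).
  rewrite -integral_itv_obnd_cbnd; last first.
    by apply/measurable_EFinP; apply: measurable_funTS; exact: continuous_measurable_fun.
  congr fine; apply: eq_integral => t; rewrite inE/= in_itv/= andbT => t0.
  rewrite /G addrK (mulrC n%:R) powRrM powR12_sqrt ?powR_mulrn ?sqrtr_ge0//; exact: ltW.
have F0 : (\int[lebesgue_measure]_(t in `[0%R, +oo[) (G t)%:E =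
  2%:E * \int[lebesgue_measure]_(t in `[0%R, +oo[) (gauss_moment R n.+1 t)%:E)%E.
  have sqy : (fun k => k%:R ^+ 2 : R) n @[n --> \oo] --> +oo.
    exact: (cvg_comp _ _ (@cvgr_idn R) (@cvgr_expr2 R)).
  have nd : nondecreasing_seq (fun k => k%:R ^+ 2 : R).
    by move=> i j ij; rewrite -!natrX ler_nat leq_exp2r.
  have := ge0_cvg_integral_itv0y R G _ cG (fun x _ => G0 x) nd sqy.
  rewrite (eq_cvg _ _ E) => /(cvg_unique (@ereal_hausdorff R)); apply.
  apply: cvgeZl => //.
  apply: (ge0_cvg_integral_itv0y R _ _ (c _) (gauss_moment_ge0 R _) _ (@cvgr_idn R)).
  by move=> i j; rewrite ler_nat.
rewrite F0 fineM//.
exact: fin_num_integral_gauss_moment.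
Qed.

Lemma Gamma_nat (R : realType) n : Gamma (n%:R + 1 : R) = n`!%:R.
Proof.
have -> : n%:R + 1 = n.*2%:R / 2 + 1 :> R by rewrite -muln2 natrM mulfK.
by rewrite Gamma_half /Rintegral integral_gauss_moment_odd /= mulrC divfK.
Qed.

Lemma Gamma_nat_half (R : realType) n :
  Gamma (n%:R + 3 / 2 : R) = pochhammer (1 / 2) n.+1 * Num.sqrt pi.
Proof.
have -> : n%:R + 3 / 2 = n.*2.+1%:R / 2 + 1 :> R.
  by rewrite -(addn1 n.*2) natrD -muln2 natrM; field.
by rewrite Gamma_half -doubleS /Rintegral integral_gauss_moment_even/=; field.
Qed.

(* Wallis' inequality, in the form [Gamma(n + 3/2)^2 <= Gamma(n + 1) Gamma(n + 2)]. *)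
Lemma pochhammer_half_sqr_le (R : realType) n :
  pi * pochhammer (1 / 2 : R) n.+1 ^+ 2 <= n`!%:R * n.+1`!%:R.
Proof.
have mD : measurable (`[0%R, +oo[ : set (measurableTypeR R)) by exact: measurable_itv.
have int k : lebesgue_measure.-integrable `[0%R, +oo[ (EFin \o gauss_moment R k).
  apply/integrableP; split.
    apply/measurable_EFinP; apply: measurable_funTS.
    by apply: continuous_measurable_fun; exact: continuous_gauss_moment.
  have -> : (\int[lebesgue_measure]_(y in `[0%R, +oo[) `|(EFin \o gauss_moment R k) y| =
      \int[lebesgue_measure]_(y in `[0%R, +oo[) (gauss_moment R k y)%:E)%E.
    apply: eq_integral => y; rewrite inE/= in_itv/= andbT => y0.
    by rewrite /= ger0_norm ?gauss_moment_ge0.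
  by rewrite ltey_eq fin_num_integral_gauss_moment.
pose M k := \int[lebesgue_measure]_(y in `[0%R, +oo[) gauss_moment R k y.
(* Cauchy-Schwarz in the form of a weighted arithmetic-geometric inequality, integrated from the
   pointwise bound (y - 2c)^2 >= 0. *)
have AMGM c : 0 < c -> M n.+1.*2 <= c * M n.*2.+1 + c^-1 / 4 * M n.+1.*2.+1.
  move=> c0.
  have intZ a k : lebesgue_measure.-integrable `[0%R, +oo[
      (EFin \o (fun y => a * gauss_moment R k y)).
    by apply: (@integrableZl _ _ _ _ _ mD a (EFin \o gauss_moment R k)); exact: int.
  rewrite -!RintegralZl//; [|exact: int..].
  rewrite -RintegralD//; [|exact: intZ..].
  apply: le_Rintegral => //.
    exact: (@integrableD _ _ _ _ _ mD (EFin \o (fun y => c * gauss_moment R n.*2.+1 y))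
      (EFin \o (fun y => c^-1 / 4 * gauss_moment R n.+1.*2.+1 y))).
  move=> y; rewrite /= in_itv/= andbT => y0.
  have -> : c * gauss_moment R n.*2.+1 y + c^-1 / 4 * gauss_moment R n.+1.*2.+1 y =
      gauss_moment R n.+1.*2 y + c^-1 / 4 * (y - 2 * c) ^+ 2 * gauss_moment R n.*2.+1 y.
    rewrite /gauss_moment doubleS !(exprS y n.*2.+2) !(exprS y n.*2.+1); field.
    by rewrite lt0r_neq0.
  rewrite lerDl mulr_ge0 ?gauss_moment_ge0// mulr_ge0 ?sqr_ge0//.
  by rewrite divr_ge0 ?invr_ge0 ?ltW.
have f0 k : 0 < k`!%:R :> R by rewrite ltr0n fact_gt0.
have p0 : 0 < pochhammer (1 / 2 : R) n.+1.
  by rewrite /pochhammer big_mkord; apply: prodr_gt0 => i _; rewrite ltr_wpDr ?ler0n ?divr_gt0.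
have s0 : 0 < Num.sqrt pi :> R by rewrite sqrtr_gt0 pi_gt0.
move: AMGM; rewrite /M /Rintegral !integral_gauss_moment_odd integral_gauss_moment_even/=.
set P := pochhammer _ _; set S := Num.sqrt pi; pose X := P * S.
set A : R := n`!%:R; set B : R := n.+1`!%:R.
have -> : pi * P ^+ 2 = X * X.
  by rewrite -(@sqr_sqrtr _ pi) ?pi_ge0// -/S /X; ring.
have A0 : 0 < A by exact: f0.
have X0 : 0 < X by rewrite mulr_gt0.
(* The weight c = X / (2A) avoids square roots: the bound becomes X/2 <= X/4 + AB / (4X), that is
   X^2 <= AB. *)
have c0 : 0 < X / (2 * A) by rewrite divr_gt0// mulr_gt0.
move=> /(_ _ c0).
have -> : X / (2 * A) * (A / 2) + (X / (2 * A))^-1 / 4 * (B / 2) = X / 4 + A * B / (4 * X).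
  by field; rewrite !lt0r_neq0.
rewrite mulrA -/X -lerBlDl ler_pdivlMr ?mulr_gt0//.
by congr (_ <= _); field.
Qed.

End GammaValues.

(** * Terminating hypergeometric series *)

Lemma pochhammer0 (R : realType) (x : R) : pochhammer x 0 = 1.
Proof. by rewrite /pochhammer big_geq. Qed.

Lemma pochhammerSr (R : realType) (x : R) k :
  pochhammer x k.+1 = pochhammer x k * (x + k%:R).
Proof. by rewrite /pochhammer big_nat_recr. Qed.

Lemma pochhammerSl (R : realType) (x : R) k :
  pochhammer x k.+1 = x * pochhammer (x + 1) k.
Proof.
rewrite /pochhammer big_nat_recl//= addr0; congr (_ * _).
by apply: eq_bigr => i _; rewrite -addrA -natr1 (addrC 1).
Qed.

Lemma pochhammer_gt0 (R : realType) (x : R) k : 0 < x -> 0 < pochhammer x k.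
Proof.
move=> x0; rewrite /pochhammer; apply: prodr_gt0 => i _.
by rewrite ltr_wpDr ?ler0n.
Qed.

Lemma pochhammer_oppn (R : realType) (m k : nat) :
  pochhammer (- m%:R : R) k = (-1) ^+ k * (m ^_ k)%:R.
Proof.
elim: k => [|k IH]; first by rewrite pochhammer0 mul1r.
rewrite pochhammerSr IH ffactnSr natrM exprS.
have [km|mk] := leqP k m; first by rewrite natrB//; ring.
by rewrite ffact_small// mulr0n !(mul0r, mulr0).
Qed.

(** The terminating series F(b, -m; c; y), with (-m)_j / j! written as a signed binomial
    coefficient. *)
Definition hypF (R : realType) (b c : R) (m : nat) (y : R) : R :=
  \sum_(j < m.+1) 'C(m, j)%:R * (- y) ^+ j * (pochhammer b j / pochhammer c j).

(** The partial sums are constant from index m + 1 on, since (-m)_k = 0 for k > m. *)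
Lemma hyp2F1_oppn (R : realType) (b c y : R) m :
  hyp2F1 b (- m%:R) c y = hypF R b c m y.
Proof.
rewrite /hyp2F1 /hypF; apply: lim_near_cst => //; near=> n.
have mn : (m.+1 <= n)%N by near: n; exists m.+1.
rewrite seriesEnat/= (big_cat_nat (leq0n _) mn)//= [X in _ + X]big_nat_cond.
rewrite [X in _ + X]big1 ?addr0; last first.
  move=> k /andP[/andP[mk _] _].
  by rewrite pochhammer_oppn ffact_small// mulr0n !(mul0r, mulr0).
rewrite big_mkord; apply: eq_bigr => k _.
have k0 : k`!%:R != 0 :> R by rewrite pnatr_eq0 -lt0n fact_gt0.
rewrite pochhammer_oppn -bin_ffact natrM (exprNn y) -[y ^+ k in RHS](divfK k0); ring.
Unshelve. all: by end_near. Qed.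

Lemma hypF0 (R : realType) (b c y : R) : hypF R b c 0 y = 1.
Proof. by rewrite /hypF big_ord1 bin0 expr0 !pochhammer0 divr1 !mulr1. Qed.

(** Pascal's rule; the shifted part absorbs the leading factors of the Pochhammer symbols. *)
Lemma hypFS (R : realType) (b c y : R) m : 0 < c ->
  hypF R b c m.+1 y = hypF R b c m y - y * (b / c) * hypF R (b + 1) (c + 1) m y.
Proof.
move=> c0; rewrite /hypF.
have -> : \sum_(j < m.+1) 'C(m, j)%:R * (- y) ^+ j * (pochhammer b j / pochhammer c j) =
    \sum_(j < m.+2) 'C(m, j)%:R * (- y) ^+ j * (pochhammer b j / pochhammer c j).
  by rewrite [RHS]big_ord_recr/= bin_small// !mul0r addr0.
rewrite !(big_ord_recl m.+1)/= !bin0 -addrA; congr (_ + _).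
rewrite mulr_sumr -sumrB; apply: eq_bigr => i _.
rewrite /bump/= add1n binS natrD !pochhammerSl exprS.
have p0 : pochhammer (c + 1) i != 0 by rewrite lt0r_neq0// pochhammer_gt0// addr_gt0.
by field; rewrite p0 lt0r_neq0.
Qed.

(** Termwise this is (c - b) (b)_i + b (b+1)_i = (c + i) (b)_i. *)
Lemma hypF_split (R : realType) (b c y : R) m : 0 < c ->
  hypF R b c m y = (c - b) / c * hypF R b (c + 1) m y + b / c * hypF R (b + 1) (c + 1) m y.
Proof.
move=> c0; rewrite /hypF !mulr_sumr -big_split/=; apply: eq_bigr => i _.
have p0 : pochhammer (c + 1) i != 0 by rewrite lt0r_neq0// pochhammer_gt0// addr_gt0.
have q0 : pochhammer c i != 0 by rewrite lt0r_neq0// pochhammer_gt0.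
have cb : b * pochhammer (b + 1) i = pochhammer b i * (b + i%:R).
  by rewrite -pochhammerSl pochhammerSr.
have cc : c * pochhammer (c + 1) i = pochhammer c i * (c + i%:R).
  by rewrite -pochhammerSl pochhammerSr.
have ci : c + i%:R != 0 by rewrite lt0r_neq0// ltr_wpDr ?ler0n.
have cn : c != 0 by rewrite lt0r_neq0.
have -> : pochhammer (c + 1) i = pochhammer c i * (c + i%:R) / c.
  by rewrite -cc mulrAC divff// mul1r.
transitivity ('C(m, i)%:R * (- y) ^+ i / (pochhammer c i * (c + i%:R)) *
   ((c - b) * pochhammer b i + b * pochhammer (b + 1) i)).
  by rewrite cb; field; rewrite ?q0 ?ci.
by field; rewrite ?q0 ?ci ?cn.
Qed.

(** For 0 < b <= c and y <= 1 both coefficients are nonnegative, so positivity follows by induction;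
    at y = 1 the second term drops out, which gives Chu-Vandermonde. *)
Lemma hypFS_split (R : realType) (b c y : R) m : 0 < c ->
  hypF R b c m.+1 y = (c - b) / c * hypF R b (c + 1) m y
                      + (1 - y) * (b / c) * hypF R (b + 1) (c + 1) m y.
Proof. by move=> c0; rewrite hypFS// (hypF_split _ _ _ y)//; ring. Qed.

Lemma hypF_ge0 (R : realType) (b c y : R) m :
  0 < b -> b <= c -> y <= 1 -> 0 <= hypF R b c m y.
Proof.
move=> + + y1; elim: m b c => [|m IH] b c b0 bc; first by rewrite hypF0.
have c0 : 0 < c by exact: lt_le_trans bc.
have [b0' c0'] := (ltW b0, ltW c0).
rewrite hypFS_split// addr_ge0// mulr_ge0//.
- by rewrite divr_ge0 ?subr_ge0.
- by rewrite IH// (le_trans bc)// lerDl.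
- by rewrite mulr_ge0 ?subr_ge0// divr_ge0.
- by rewrite IH ?lerD2r// addr_gt0.
Qed.

Lemma hypF_at1 (R : realType) (b c : R) m : 0 < c ->
  hypF R b c m 1 = pochhammer (c - b) m / pochhammer c m.
Proof.
elim: m c => [|m IH] c c0; first by rewrite hypF0 !pochhammer0 divr1.
rewrite hypFS_split// subrr !mul0r addr0 IH ?addr_gt0// !pochhammerSl addrAC.
by rewrite invfM; ring.
Qed.

(** With b = (n+1)/2 and y = t^2, the function y^b F(b, -m; c; y) is a polynomial in t with
    derivative 2b t^n F(b+1, -m; c; t^2). This is nonnegative on [0, 1] because b + 1 <= c. *)
Lemma expr_hypF_le (R : realType) (c t : R) n m :
  n.+3%:R / 2 <= c -> 0 <= t -> t <= 1 ->
  t ^+ n.+1 * hypF R (n.+1%:R / 2) c m (t ^+ 2) <= hypF R (n.+1%:R / 2) c m 1.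
Proof.
set b : R := n.+1%:R / 2 => bc t0 t1.
pose p : {poly R} := \sum_(j < m.+1)
  ('C(m, j)%:R * (- 1) ^+ j * (pochhammer b j / pochhammer c j)) *: 'X^(j.*2 + n.+1).
have pE x : p.[x] = x ^+ n.+1 * hypF R b c m (x ^+ 2).
  rewrite /p horner_sum /hypF mulr_sumr; apply: eq_bigr => j _.
  by rewrite hornerZ hornerXn exprD -mul2n exprM (exprNn (x ^+ 2)); ring.
have pD x : p^`().[x] = n.+1%:R * x ^+ n * hypF R (b + 1) c m (x ^+ 2).
  rewrite /p raddf_sum horner_sum /hypF mulr_sumr; apply: eq_bigr => j _.
  rewrite /= derivZ hornerZ derivXn hornerMn hornerXn addnS/= exprD -mul2n exprM.
  rewrite (exprNn (x ^+ 2)) -(mulr_natr _ (2 * j + n).+1).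
  have b0 : b != 0 by rewrite /b mulf_neq0// ?invr_eq0 ?pnatr_eq0.
  have -> : pochhammer (b + 1) j = pochhammer b j * (b + j%:R) / b.
    by rewrite -pochhammerSr pochhammerSl mulrAC divff// mul1r.
  have -> : (2 * j + n).+1%:R = 2 * (b + j%:R).
    by rewrite /b -natr1 (natrD _ (2 * j)) (natrM _ 2 j) -natr1; field.
  have -> : n.+1%:R = 2 * b by rewrite /b; field.
  by field; rewrite b0 lt0r_neq0// pochhammer_gt0// (lt_le_trans _ bc)// divr_gt0.
have -> : hypF R b c m 1 = p.[1] by rewrite pE !expr1n mul1r.
rewrite -pE; apply: (@ger0_derive1_ndecr _ (horner p) 0 1) => //.
- move=> x; rewrite in_itv/= => /andP[x0 x1].
  rewrite derive1E; case: (is_derive_poly p x) => _ ->.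
  rewrite pD; apply: mulr_ge0; first by rewrite mulr_ge0 ?exprn_ge0 ?ltW.
  apply: hypF_ge0.
  - by rewrite addr_gt0// /b divr_gt0.
  - apply: le_trans bc; rewrite /b -(addn2 n.+1) natrD; lra.
  - by rewrite expr_le1// ltW.
- by apply: continuous_subspaceT => x; exact: continuous_horner.
Qed.

(** * Delannoy and ballot numbers *)

Lemma coef_linear_exp (R : comNzRingType) (a b : R) n i :
  ((a%:P + b *: 'X) ^+ n)`_i = 'C(n, i)%:R * a ^+ (n - i) * b ^+ i.
Proof.
have -> : (a%:P + b *: 'X) ^+ n = \poly_(j < n.+1) ('C(n, j)%:R * a ^+ (n - j) * b ^+ j).
  rewrite exprDn poly_def; apply: eq_bigr => j _.
  rewrite exprZn -polyC_exp mul_polyC scalerA scalerMnl.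
  by congr (_ *: _); rewrite -mulr_natl mulrA.
rewrite coef_poly; case: ltnP => // ni; rewrite bin_small//.
by rewrite mulr0n !mul0r.
Qed.

(* Constant term of [(be + t z) ^ m (be + t / z) ^ i]; shifting by [z ^ m] makes it a
   coefficient of a genuine polynomial. *)
Definition delannoy (R : comNzRingType) (be t : R) (m i : nat) : R :=
  ((t%:P + be *: 'X) ^+ m * (be%:P + t *: 'X) ^+ i)`_m.

(** The upper limit [N] is free, the extra terms being zero, so that sums with different natural
    ranges can be compared term by term. *)
Lemma delannoyE (R : comNzRingType) (be t : R) m i N : (minn m i < N)%N ->
  delannoy R be t m i =
  \sum_(0 <= k < N) ('C(m, k) * 'C(i, k))%:R * (t ^+ 2) ^+ k * be ^+ (m + i - 2 * k).
Proof.
move=> miN; set F := fun k => ('C(m, k) * 'C(i, k))%:R * (t ^+ 2) ^+ k * be ^+ (m + i - 2 * k).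
have F0 k : (minn m i < k)%N -> F k = 0.
  by rewrite gtn_min /F => /orP[] h; rewrite (bin_small h) ?muln0 ?mul0n mulr0n !mul0r.
have FN n : (minn m i < n)%N -> \sum_(0 <= k < n) F k = \sum_(0 <= k < (minn m i).+1) F k.
  move=> h; rewrite (big_cat_nat (leq0n _) h)/= [X in _ + X]big_nat_cond.
  by rewrite [X in _ + X]big1 ?addr0// => k /andP[/andP[mk _] _]; exact: F0.
rewrite FN// -(FN m.+1) ?ltnS ?geq_minl// /delannoy coefMr big_mkord.
apply: eq_bigr => -[k /= km] _; rewrite /F !coef_linear_exp bin_sub// subKn//.
have [ik|ki] := ltnP i k; first by rewrite (bin_small ik) muln0 mulr0n !(mul0r, mulr0).
have -> : (m + i - 2 * k = (m - k) + (i - k))%N.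
  by rewrite mul2n -addnn subnDA addnBAC// -addnBA// addnC addnBA.
by rewrite natrM exprD -exprM mul2n -addnn exprD; ring.
Qed.

Lemma delannoyC (R : comNzRingType) (be t : R) m i : delannoy R be t m i = delannoy R be t i m.
Proof.
rewrite (@delannoyE _ _ _ m i (m + i).+1) ?ltnS ?(leq_trans (geq_minl _ _)) ?leq_addr//.
rewrite (@delannoyE _ _ _ i m (m + i).+1) ?ltnS ?(leq_trans (geq_minr _ _)) ?leq_addr//.
by apply: eq_bigr => k _; rewrite mulnC (addnC m).
Qed.

Lemma delannoyn0 (R : comNzRingType) (be t : R) m : delannoy R be t m 0 = be ^+ m.
Proof. by rewrite (@delannoyE _ _ _ _ _ 1) ?minn0// big_nat1 !bin0 addn0 muln0 subn0 !mul1r. Qed.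

Lemma delannoySS (R : comNzRingType) (be t : R) m i :
  delannoy R be t m.+1 i.+1 = be * delannoy R be t m.+1 i + be * delannoy R be t m i.+1
    + (t ^+ 2 - be ^+ 2) * delannoy R be t m i.
Proof.
rewrite /delannoy.
set u := be%:P + _; set v := t%:P + _.
(* In Laurent form: AB = be (A + B) + t^2 - be^2. *)
have uv : v * u = be *: v + be *: (u * 'X) + (t ^+ 2 - be ^+ 2) *: 'X.
  rewrite /u /v -!mul_polyC polyCB !polyC_exp; ring.
have -> : v ^+ m.+1 * u ^+ i.+1 = v ^+ m * u ^+ i * (v * u) by rewrite !exprS; ring.
rewrite uv !mulrDr -!scalerAr !coefD !coefZ.
rewrite (mulrA _ u 'X) !coefMX/=.
have -> : v ^+ m * u ^+ i * v = v ^+ m.+1 * u ^+ i by rewrite exprS; ring.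
by have -> : v ^+ m * u ^+ i * u = v ^+ m * u ^+ i.+1 by rewrite exprS; ring.
Qed.

(* Coefficient of [z ^ k] in the Laurent polynomial [(be + t z) (be + t / z)] to the power [m]. *)
Definition trinom (R : comNzRingType) (be t : R) (m k : nat) : R :=
  (((t%:P + be *: 'X) * (be%:P + t *: 'X)) ^+ m)`_(m + k).

Section Trinom.
Context (R : comNzRingType) (be t : R).

Let Q : {poly R} := (t%:P + be *: 'X) * (be%:P + t *: 'X).

Lemma trinom_delannoy0 m : trinom R be t m 0 = delannoy R be t m m.
Proof. by rewrite /trinom /delannoy addn0 exprMn. Qed.

(** Unequal exponents leave a spare linear factor times [Q ^+ m]. *)
Lemma trinom_delannoy1 m :
  delannoy R be t m.+1 m = be * trinom R be t m 0 + t * trinom R be t m 1.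
Proof.
rewrite /delannoy /trinom addn0 addn1 -/Q.
have -> : (t%:P + be *: 'X) ^+ m.+1 * (be%:P + t *: 'X) ^+ m =
   be *: (Q ^+ m * 'X) + t *: Q ^+ m.
  by rewrite /Q exprS exprMn -!mul_polyC; ring.
by rewrite coefD !coefZ coefMX.
Qed.

Lemma trinom_delannoy2 m :
  delannoy R be t m.+2 m = be ^+ 2 * trinom R be t m 0 + 2 * be * t * trinom R be t m 1
    + t ^+ 2 * trinom R be t m 2.
Proof.
rewrite /delannoy /trinom addn0 addn1 addn2 -/Q.
have -> : (t%:P + be *: 'X) ^+ m.+2 * (be%:P + t *: 'X) ^+ m =
   (be ^+ 2) *: (Q ^+ m * 'X * 'X) + (2 * be * t) *: (Q ^+ m * 'X) + (t ^+ 2) *: Q ^+ m.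
  by rewrite /Q !exprS !exprMn -!mul_polyC !polyCM; ring.
by rewrite !coefD !coefZ !coefMX.
Qed.

Lemma trinomSS m k :
  trinom R be t m.+1 k.+1 = be * t * trinom R be t m k.+2
    + (be ^+ 2 + t ^+ 2) * trinom R be t m k.+1 + be * t * trinom R be t m k.
Proof.
rewrite /trinom -/Q !addnS addSn.
have -> : Q ^+ m.+1 = (be * t) *: Q ^+ m + (be ^+ 2 + t ^+ 2) *: (Q ^+ m * 'X)
   + (be * t) *: (Q ^+ m * 'X * 'X).
  rewrite exprSr; set q := Q ^+ m; rewrite /Q -!mul_polyC !polyCD !polyCM; ring.
by rewrite !coefD !coefZ !coefMX.
Qed.

(** At k = 0 the recursion meets the coefficient of 1/z, which equals that of z; the symmetry enters
    through [delannoyC]. *)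
Lemma trinomS0 m :
  trinom R be t m.+1 0 = (be ^+ 2 + t ^+ 2) * trinom R be t m 0
    + 2 * be * t * trinom R be t m 1.
Proof.
rewrite trinom_delannoy0 delannoySS (delannoyC _ _ _ m m.+1) trinom_delannoy1 -trinom_delannoy0.
ring.
Qed.

Lemma trinom0 k : trinom R be t 0 k = (k == 0%N)%:R.
Proof. by rewrite /trinom expr0 coef1. Qed.

Lemma trinom_eq0 m k : (m < k)%N -> trinom R be t m k = 0.
Proof.
elim: m k => [|m IH] [|k]//; first by rewrite trinom0.
by rewrite ltnS => mk; rewrite trinomSS !IH ?mulr0 ?addr0// ltnW// ltnW.
Qed.

End Trinom.

(* Entry [(0, k)] of the [m]-th power of the Jacobi matrix with diagonal [be ^+ 2 + t ^+ 2]
   and off-diagonal [be * t]; see [ballotS0] and [ballotSS]. *)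
Definition ballot (R : comNzRingType) (be t : R) (m k : nat) : R :=
  trinom R be t m k - trinom R be t m k.+2.

Section Ballot.
Context (R : comNzRingType) (be t : R).
Local Notation p := (ballot R be t).
Local Notation a := (be ^+ 2 + t ^+ 2).
Local Notation b := (be * t).

Lemma ballot0 k : p 0 k = (k == 0%N)%:R.
Proof. by rewrite /ballot !trinom0 subr0. Qed.

(** Reflection principle: the difference defining [ballot] would vanish at k = -1, so no further
    boundary term appears. *)
Lemma ballotS0 m : p m.+1 0 = a * p m 0 + b * p m 1.
Proof. by rewrite /ballot trinomS0 trinomSS; ring. Qed.

Lemma ballotSS m k : p m.+1 k.+1 = a * p m k.+1 + b * (p m k + p m k.+2).
Proof. by rewrite /ballot !trinomSS; ring. Qed.

Lemma ballot_eq0 m k : (m < k)%N -> p m k = 0.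
Proof. by move=> mk; rewrite /ballot !trinom_eq0 ?subr0// ltnW// ltnW. Qed.

Lemma sum_ballot m : \sum_(k < m.+1) p m k = trinom R be t m 0 + trinom R be t m 1.
Proof.
pose f k := trinom R be t m k + trinom R be t m k.+1.
have pE k : p m k = f k - f k.+1 by rewrite /ballot /f; ring.
rewrite -(big_mkord xpredT (p m)) (@telescope_sumr_eq _ 0 m.+1 (fun k => - f k))//.
  by rewrite opprK /f (trinom_eq0 _ _ _ _ m.+1)// (trinom_eq0 _ _ _ _ m.+2)// addr0 oppr0 add0r.
by move=> k _; rewrite pE opprK addrC.
Qed.

(** The weights s^k form an eigenvector of the Jacobi matrix with eigenvalue a + b (s + 1/s), up to
    a boundary term at k = 0. Writing t = al s avoids dividing by s. *)
Lemma sum_expr_ballotS (al s : R) m : t = al * s ->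
  \sum_(k < m.+2) s ^+ k * p m.+1 k =
  (be + al) * (be + al * s ^+ 2) * (\sum_(k < m.+1) s ^+ k * p m k) - al * be * p m 0.
Proof.
move=> tE; set V := \sum_(k < m.+1) _.
have V1 : \sum_(k < m.+1) s ^+ k.+1 * p m k.+1 = V - p m 0.
  rewrite /V [in RHS]big_ord_recl mul1r addrAC subrr add0r big_ord_recr/=.
  by rewrite ballot_eq0// mulr0 addr0; apply: eq_bigr.
have V2 : \sum_(k < m.+1) s ^+ k.+2 * p m k.+2 = V - p m 0 - s * p m 1.
  rewrite -V1 [in RHS]big_ord_recl/= expr1 addrAC subrr add0r big_ord_recr/=.
  by rewrite ballot_eq0// mulr0 addr0; apply: eq_bigr.
rewrite big_ord_recl ballotS0 expr0 mul1r.
have -> : \sum_(i < m.+1) s ^+ (bump 0 i) * p m.+1 (bump 0 i) =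
    a * (V - p m 0) + b * s * V + be * al * (V - p m 0 - s * p m 1).
  rewrite -V2 -V1 /V !mulr_sumr -!big_split/=; apply: eq_bigr => k _.
  by rewrite /bump/= add1n ballotSS !exprS tE; ring.
by rewrite tE; ring.
Qed.

End Ballot.

(** * Positivity and monotonicity of the ballot numbers *)

Section BallotOrder.
Context (R : realFieldType) (be t : R).
Local Notation p := (ballot R be t).
Local Notation a := (be ^+ 2 + t ^+ 2).
Local Notation b := (be * t).

Lemma ballot_ge0 m k : 0 <= be -> 0 <= t -> 0 <= p m k.
Proof.
move=> be0 t0; elim: m k => [|m IH] k; first by rewrite ballot0 ler0n.
have a0 : 0 <= a by rewrite addr_ge0 ?sqr_ge0.
have b0 : 0 <= b by rewrite mulr_ge0.
case: k => [|k]; [rewrite ballotS0|rewrite ballotSS]; apply: addr_ge0;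
  by apply: mulr_ge0 => //; exact: addr_ge0.
Qed.

(** The weight k + 1 is discretely harmonic, 2(k+1) = k + (k+2), so the quotients obey a three-term
    recursion with nonnegative coefficients. It preserves monotonicity because a >= 2b. *)
Lemma ballot_div_le m k : 0 <= be -> 0 <= t ->
  p m k.+1 / k.+2%:R <= p m k / k.+1%:R.
Proof.
move=> be0 t0; pose q m k := p m k / k.+1%:R.
have pq n j : p n j = j.+1%:R * q n j by rewrite mulrC divfK.
have b0 : 0 <= b by rewrite mulr_ge0.
have ab : b *+ 2 <= a.
  by rewrite -subr_ge0 (_ : _ - _ = (be - t) ^+ 2) ?sqr_ge0//; ring.
rewrite -/(q m k.+1) -/(q m k).
elim: m k => [|m IH] k.
  by rewrite /q !ballot0 mul0r divr_ge0 ?ler0n.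
set c : R := k%:R; have c0 : 0 <= c by exact: ler0n.
have c1 : k.+1%:R = c + 1 :> R by rewrite -natr1.
have c2 : k.+2%:R = c + 2 :> R by rewrite -addn2 natrD.
have c3 : k.+3%:R = c + 3 :> R by rewrite -addn3 natrD.
rewrite -subr_ge0 -(pmulr_rge0 _ (_ : 0 < (c + 1) * (c + 2))); last first.
  by rewrite mulr_gt0 ?ltr_wpDl.
(* The new difference is a nonnegative combination of old ones; [r] holds the contribution of the
   difference at k - 1, absent for k = 0. *)
suff [r [r0 ->]] : exists r, 0 <= r /\ (c + 1) * (c + 2) * (q m.+1 k - q m.+1 k.+1) =
   (a * (c + 1) * (c + 2) - b) * (q m k - q m k.+1)
   + r + b * (c + 1) * (c + 3) * (q m k.+1 - q m k.+2).
  rewrite !addr_ge0// mulr_ge0 ?subr_ge0 ?IH//; last by rewrite !mulr_ge0// addr_ge0.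
  nra.
case: k @c c0 c1 c2 c3 => [|k] c c0 c1 c2 c3.
  exists 0; split=> //; rewrite addr0 {1 2}/q ballotS0 ballotSS !pq c1 c2 c3 /c.
  by field.
exists (b * c * (c + 2) * (q m k - q m k.+1)); split.
  rewrite mulr_ge0 ?subr_ge0 ?IH//; apply: mulr_ge0; last exact: addr_ge0.
  exact: mulr_ge0.
rewrite {1 2}/q !ballotSS !pq c1 c2 c3 -/c.
by field; rewrite !lt0r_neq0 ?ltr_wpDl.
Qed.

Lemma ballot_le m k : 0 <= be -> 0 <= t -> p m k <= k.+1%:R * p m 0.
Proof.
move=> be0 t0; rewrite mulrC -ler_pdivrMr ?ltr0n//.
elim: k => [|k IH]; first by rewrite divr1.
exact: le_trans (ballot_div_le _ _ be0 t0) IH.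
Qed.

End BallotOrder.

(** The full series is 1 / (1 - s)^2; the remainder is explicit and nonnegative. *)
Lemma sum_succ_expr_le (R : realFieldType) (s : R) n : 0 <= s -> s <= 1 ->
  (1 - s) ^+ 2 * (\sum_(k < n) k.+1%:R * s ^+ k) <= 1.
Proof.
move=> s0 s1.
suff -> : (1 - s) ^+ 2 * (\sum_(k < n) k.+1%:R * s ^+ k) =
    1 - (s ^+ n + n%:R * s ^+ n * (1 - s)).
  by rewrite gerBl addr_ge0 ?exprn_ge0// !mulr_ge0 ?exprn_ge0 ?subr_ge0.
elim: n => [|n IH]; first by rewrite big_ord0 mulr0 expr0 mul0r mul0r addr0 subrr.
by rewrite big_ord_recr/= mulrDr IH -natr1 (exprS s n); ring.
Qed.

(** * Catalan sums and their hypergeometric form *)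

(** Binomial expansion of AB = (be + t)^2 + be t (1 - z)^2 / z, the second term being -be t times
    the discrete Laplacian. *)
Lemma coef_trinom (R : comNzRingType) (be t : R) m k : trinom R be t m k =
  \sum_(j < m.+1) 'C(m, j)%:R * ((be + t) ^+ 2) ^+ (m - j) * (- (be * t)) ^+ j
    * ((-1) ^+ k * 'C(j.*2, j + k)%:R).
Proof.
rewrite /trinom.
have -> : (t%:P + be *: 'X) * (be%:P + t *: 'X) =
    ((be + t) ^+ 2) *: 'X + (be * t) *: (1%:P + (-1) *: 'X) ^+ 2 :> {poly R}.
  by rewrite -!mul_polyC !polyCM polyCD !polyCN; ring.
rewrite exprDn coef_sum; apply: eq_bigr => -[j /= jm] _.
rewrite (exprZn (be * t)) (exprZn ((be + t) ^+ 2)) -scalerAl -scalerAr !coefMn !coefZ coefXnM.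
rewrite ltnNge (leq_trans (leq_subr _ _)) ?leq_addr//=.
rewrite (_ : m + k - (m - j) = j + k)%N; last first.
  by rewrite -addnBAC ?leq_subr// subKn.
rewrite -(exprM _ 2 j) mul2n coef_linear_exp expr1n mulr1.
rewrite -(mulr_natl _ 'C(m, j)) (exprNn (be * t)) (exprD _ j k); ring.
Qed.

Lemma bin_center (R : realType) j :
  'C(j.*2, j)%:R = 4 ^+ j * (pochhammer (1 / 2) j / j`!%:R) :> R.
Proof.
elim: j => [|j IH]; first by rewrite pochhammer0 fact0 bin0 divr1 mulr1.
have H : (j.+1 * j.+1 * 'C(j.+1.*2, j.+1) = j.+1 * 2 * (j.*2.+1 * 'C(j.*2, j)))%N.
  rewrite -mulnA -mul_bin_diag doubleS /= (mul_bin_down j.*2.+1 j).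
  have -> : (j.*2.+1 - j = j.+1)%N by rewrite -addnn -addSn addnK.
  by rewrite -doubleS -muln2 -!mulnA (mulnCA 2).
have j0 : j.+1%:R != 0 :> R by rewrite pnatr_eq0.
have f0 : j`!%:R != 0 :> R by rewrite pnatr_eq0 -lt0n fact_gt0.
have {}H := congr1 (fun n => n%:R : R) H; rewrite !natrM {}IH in H.
rewrite pochhammerSr factS natrM exprS; apply: (mulfI (mulf_neq0 j0 j0)).
rewrite {}H.
rewrite -(natr1 j.*2) -muln2 natrM; move: j0; rewrite -(natr1 j) => j0.
by field; rewrite f0.
Qed.

Lemma bin_centerS (R : comNzRingType) j :
  'C(j.*2, j.+1)%:R * j.+1%:R = 'C(j.*2, j)%:R * j%:R :> R.
Proof. by rewrite -!natrM mulnC mul_bin_left -addnn addnK mulnC. Qed.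

Lemma bin_centerSS (R : comNzRingType) j :
  'C(j.*2, j.+2)%:R * (j.+1%:R * j.+2%:R) = 'C(j.*2, j)%:R * (j%:R * (j%:R - 1)) :> R.
Proof.
case: j => [|j]; first by rewrite !mul0r mulr0.
have : (j.+3 * 'C(j.+1.*2, j.+3) = j * 'C(j.+1.*2, j.+2))%N.
  by rewrite mul_bin_left doubleS -addnn !subSS -addSn addnK.
move/(congr1 (fun n => n%:R : R)); rewrite !natrM => H.
transitivity (j.+3%:R * 'C(j.+1.*2, j.+3)%:R * j.+2%:R : R); first by ring.
rewrite {}H -mulrA bin_centerS -(natr1 j); ring.
Qed.

Lemma pochhammer1 (R : realType) j : pochhammer 1 j = j`!%:R :> R.
Proof.
elim: j => [|j IH]; first by rewrite pochhammer0.
by rewrite pochhammerSr IH factS natrM -natr1; ring.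
Qed.

Lemma pochhammer2 (R : realType) j : pochhammer 2 j = j.+1`!%:R :> R.
Proof. by rewrite -pochhammer1 pochhammerSl mul1r. Qed.

Lemma pochhammer3 (R : realType) j : pochhammer 3 j = j.+2`!%:R / 2 :> R.
Proof.
rewrite -pochhammer2 pochhammerSl (_ : 2 + 1 = 3); first by field.
by ring.
Qed.

Lemma pochhammer3half (R : realType) j :
  pochhammer (3 / 2) j = 2 * pochhammer (1 / 2) j.+1 :> R.
Proof. by rewrite pochhammerSl (_ : 1 / 2 + 1 = 3 / 2 :> R); field. Qed.

(** Both sides are the Catalan number of index j. *)
Lemma sub_bin_center (R : realType) j :
  'C(j.*2, j)%:R - 'C(j.*2, j.+1)%:R = 4 ^+ j * (pochhammer (1 / 2) j / pochhammer 2 j) :> R.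
Proof.
have j0 : j.+1%:R != 0 :> R by rewrite pnatr_eq0.
have f0 : j`!%:R != 0 :> R by rewrite pnatr_eq0 -lt0n fact_gt0.
apply: (mulIf j0); rewrite mulrBl bin_centerS bin_center pochhammer2 factS natrM.
move: j0; rewrite -(natr1 j) => j0.
by field; rewrite f0.
Qed.

(** Both sides are the Catalan number of index j + 1. *)
Lemma sub_bin_center2 (R : realType) j :
  'C(j.*2, j)%:R - 'C(j.*2, j.+2)%:R = 4 ^+ j * (pochhammer (3 / 2) j / pochhammer 3 j) :> R.
Proof.
have j1 : j.+1%:R != 0 :> R by rewrite pnatr_eq0.
have j2 : j.+2%:R != 0 :> R by rewrite pnatr_eq0.
have f0 : j`!%:R != 0 :> R by rewrite pnatr_eq0 -lt0n fact_gt0.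
apply: (mulIf (mulf_neq0 j1 j2)); rewrite mulrBl bin_centerSS bin_center.
rewrite pochhammer3 pochhammer3half pochhammerSr !factS !natrM.
move: j1 j2; rewrite -(natr1 j.+1) -(natr1 j) => j1 j2.
by field; rewrite f0 j1 j2.
Qed.

(** Applied with (k, e) = (1, 1) and (2, -1): in both cases e (-1)^k = -1, so the hypothesis is a
    Catalan identity. *)
Lemma trinomD_hypF (R : realType) (be t b c e : R) m k : be + t != 0 ->
  (forall j, 'C(j.*2, j)%:R + e * (-1) ^+ k * 'C(j.*2, j + k)%:R =
     4 ^+ j * (pochhammer b j / pochhammer c j) :> R) ->
  trinom R be t m 0 + e * trinom R be t m k =
  ((be + t) ^+ 2) ^+ m * hypF R b c m (4 * be * t / (be + t) ^+ 2).
Proof.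
move=> s0 H; rewrite !coef_trinom mulr_sumr -big_split mulr_sumr/=.
apply: eq_bigr => -[j /= jm] _.
rewrite -[X in _ = _ ^+ X * _](subnK (_ : j <= m)%N)// exprD.
rewrite addn0 expr0 mul1r; set S := (be + t) ^+ 2.
have E : (- (be * t)) ^+ j * 4 ^+ j = S ^+ j * (- (4 * be * t / S)) ^+ j.
  by rewrite -!exprMn; congr (_ ^+ _); rewrite /S; field.
set h := pochhammer b j / pochhammer c j.
transitivity ('C(m, j)%:R * S ^+ (m - j) * h * ((- (be * t)) ^+ j * 4 ^+ j)).
  transitivity ('C(m, j)%:R * S ^+ (m - j) * (- (be * t)) ^+ j * (4 ^+ j * h)).
    by rewrite -H; ring.
  by ring.
by rewrite E; ring.
Qed.

Lemma sum_ballot_hypF (R : realType) (be t : R) m : be + t != 0 ->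
  \sum_(k < m.+1) ballot R be t m k =
  ((be + t) ^+ 2) ^+ m * hypF R (1 / 2) 2 m (4 * be * t / (be + t) ^+ 2).
Proof.
move=> s0; rewrite sum_ballot -[X in _ + X]mul1r; apply: trinomD_hypF => // j.
by rewrite addn1 -sub_bin_center; ring.
Qed.

Lemma ballotn0_hypF (R : realType) (be t : R) m : be + t != 0 ->
  ballot R be t m 0 =
  ((be + t) ^+ 2) ^+ m * hypF R (3 / 2) 3 m (4 * be * t / (be + t) ^+ 2).
Proof.
move=> s0; rewrite /ballot -[X in _ + X]mulN1r; apply: trinomD_hypF => // j.
by rewrite addn2 -sub_bin_center2; ring.
Qed.

(** * The bounds *)

Lemma coef_delannoy (R : realType) (ell al t : R) m : al != 0 -> t ^+ 2 = al ^+ 2 * ell ->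
  coef ell al m m.+1 / al =
  \sum_(i < m.+1) delannoy R (1 - al) t m i - \sum_(i < m) delannoy R (1 - al) t m.+1 i.
Proof.
move=> al0 tE; rewrite /coef mulrAC divff// mul1r -tE; set be := 1 - al.
have -> : \sum_(i < m.+1) delannoy R be t m i = \sum_(0 <= j < m.+1) delannoy R be t m (m - j).
  by rewrite -(big_mkord xpredT) big_nat_rev/=; apply: eq_big_nat => j _; rewrite add0n subSS.
have -> : \sum_(i < m) delannoy R be t m.+1 i =
    \sum_(0 <= j < m.+1) (if (j < m)%N then delannoy R be t m.+1 (m - j.+1) else 0).
  rewrite big_nat_recr//= ltnn addr0 -(big_mkord xpredT) big_nat_rev/=.
  by apply: eq_big_nat => j /andP[_ ->]; rewrite add0n.
rewrite -sumrB; apply: eq_big_nat => j /andP[_ jm].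
have -> : (m.+1 - 1 - j = m - j)%N by rewrite subn1.
rewrite (@delannoyE _ _ _ m (m - j) (minn m (m - j)).+1)//.
(* At j = m the integer m - 1 - j is -1 and [binz] returns 0, which is why the second sum is one
   term shorter. *)
have -> : (if (j < m)%N then delannoy R be t m.+1 (m - j.+1) else 0) =
    \sum_(0 <= k < (minn m (m - j)).+1)
    ('C(m.+1, k) * binz (m%:Z - 1 - j%:Z) k)%:R * (t ^+ 2) ^+ k * be ^+ (m + (m - j) - 2 * k).
  case: ltnP => [jm'|mj].
    rewrite (@delannoyE _ _ _ _ _ (minn m (m - j)).+1); last first.
      rewrite ltnS leq_min !geq_min leq_sub2l// orbT andbT.
      by rewrite (leq_trans (leq_subr _ _))// orbT.
    apply: eq_bigr => k _.
    have -> : m%:Z - 1 - j%:Z = (m - j.+1)%N%:Z by rewrite -subzn//; ring.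
    by rewrite addSnnS subnSK.
  have -> : m = j by apply/eqP; rewrite eqn_leq mj -ltnS jm.
  by rewrite big1// => k _; rewrite addrAC subrr sub0r /= muln0 mulr0n !mul0r.
rewrite -sumrB; apply: eq_big_nat => k _.
have -> : (m.+1)%:Z - 1 - j%:Z = (m - j)%N%:Z by rewrite -subzn//; ring.
rewrite /= addSn subn1 /= -addnBA//; ring.
Qed.

(** Obtained by summing [delannoySS] over the second index. [S] stays on both sides, since isolating
    it means dividing by 1 - be. *)
Lemma sum_delannoyS (R : realType) (be t : R) m n :
  let S := \sum_(i < n.+1) delannoy R be t m.+1 i in
  S = be * S + (be + t ^+ 2 - be ^+ 2) * (\sum_(i < n) delannoy R be t m i)
    + be * (delannoy R be t m n - delannoy R be t m.+1 n).
Proof.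
elim: n => [|n /= IH] /=.
  by rewrite big_ord1 big_ord0 !delannoyn0 exprS; ring.
rewrite (big_ord_recr n.+1)/=; move: IH; set S := \sum_(i < n.+1) delannoy _ _ _ m.+1 i => IH.
by rewrite {1}IH big_ord_recr/= delannoySS; ring.
Qed.

Lemma coef_rec (R : realType) (ell al t : R) m : al != 0 -> t ^+ 2 = al ^+ 2 * ell ->
  coef ell al m.+1 m.+2 / al = (1 - al + al * ell) * (coef ell al m m.+1 / al)
    - al * (1 - al) * ell * ballot R (1 - al) t m 0.
Proof.
move=> al0 tE; rewrite !(coef_delannoy _ _ _ _ _ al0 tE); set be := 1 - al.
set X := \sum_(i < m.+1) delannoy R be t m i; set Y := \sum_(i < m) delannoy R be t m.+1 i.
set X' := \sum_(i < m.+2) _; set Y' := \sum_(i < m.+1) delannoy R be t m.+2 i.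
have EX : X' = be * X' + (be + t ^+ 2 - be ^+ 2) * X
    + be * (delannoy R be t m m.+1 - delannoy R be t m.+1 m.+1).
  exact: sum_delannoyS.
have EY : Y' = be * Y' + (be + t ^+ 2 - be ^+ 2) * Y
    + be * (delannoy R be t m.+1 m - delannoy R be t m.+2 m).
  exact: sum_delannoyS.
(* This is what survives of the boundary terms of [EX] and [EY] once [delannoyC] cancels the other
   two. *)
have W : delannoy R be t m.+1 m.+1 - delannoy R be t m.+2 m = t ^+ 2 * ballot R be t m 0.
  rewrite trinom_delannoy2 -trinom_delannoy0 trinomS0 /ballot; ring.
apply: (mulfI al0).
transitivity ((1 - be) * (X' - Y')); first by rewrite /be; ring.
transitivity ((be + t ^+ 2 - be ^+ 2) * (X - Y) - be * (t ^+ 2 * ballot R be t m 0)).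
  rewrite -W; move: EX EY; rewrite (delannoyC _ _ _ m m.+1) => EX EY.
  have -> : (1 - be) * (X' - Y') = (X' - be * X') - (Y' - be * Y') by ring.
  rewrite {1}EX {1}EY; ring.
by rewrite tE /be; ring.
Qed.

Section Bounds.
Context (R : realType) (ell al : R).
Context (ell0 : 0 < ell) (ell1 : ell <= 1) (al0 : 0 < al) (al1 : al <= 1).
Local Notation sg := (Num.sqrt ell).
Local Notation be := (1 - al).
Local Notation ella := (1 - al + al * ell).
Local Notation p := (ballot R be (al * sg)).

Let sg0 : 0 < sg. Proof. by rewrite sqrtr_gt0. Qed.
Let sg1 : sg <= 1. Proof. by rewrite -sqrtr1 ler_wsqrtr. Qed.
Let sg2 : sg ^+ 2 = ell. Proof. by rewrite sqr_sqrtr// ltW. Qed.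
Let be0 : 0 <= be. Proof. by rewrite subr_ge0. Qed.
Let t0 : 0 <= al * sg. Proof. by rewrite mulr_ge0// ltW. Qed.
Let tE : (al * sg) ^+ 2 = al ^+ 2 * ell. Proof. by rewrite exprMn sg2. Qed.

(** Since be + al = 1, each step multiplies both summands by [ella], and the boundary term of
    [sum_expr_ballotS], scaled by [ell], is exactly the correction in [coef_rec]. *)
Lemma coef_sum_ballot m : coef ell al m m.+1 / al =
  (1 - ell) * ella ^+ m + ell * \sum_(k < m.+1) sg ^+ k * p m k.
Proof.
have a0 : al != 0 by rewrite lt0r_neq0.
elim: m => [|m IH].
  rewrite (coef_delannoy _ _ _ _ _ a0 tE) big_ord1 big_ord0 big_ord1.
  by rewrite delannoyn0 ballot0/= !expr0; ring.
rewrite (coef_rec _ _ _ _ _ a0 tE) IH (sum_expr_ballotS _ _ _ al)// sg2 exprS; ring.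
Qed.

Lemma coef_le_expr m : coef ell al m m.+1 / al <= ella ^+ m.
Proof.
have a0 : al != 0 by rewrite lt0r_neq0.
have ella0 : 0 <= ella by rewrite addr_ge0// mulr_ge0// ltW.
elim: m => [|m IH].
  rewrite coef_sum_ballot big_ord1 ballot0/= !expr0; lra.
rewrite (coef_rec _ _ _ _ _ a0 tE) exprS lerBlDr.
apply: le_trans (ler_wpM2l ella0 IH) _.
rewrite lerDl; apply: mulr_ge0; last exact: ballot_ge0.
by rewrite !mulr_ge0// ltW.
Qed.

(** One factor of ell = sg^2 joins the weight, and sg^(k+1) <= 1. *)
Lemma sum_expr_ballot_le m :
  ell * \sum_(k < m.+1) sg ^+ k * p m k <= sg * \sum_(k < m.+1) p m k.
Proof.
rewrite -{1}sg2 expr2 -mulrA (ler_wpM2l (ltW sg0))// mulr_sumr; apply: ler_sum => k _.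
by rewrite mulrA -exprS ler_piMl ?ballot_ge0// exprn_ile1// (ltW sg0).
Qed.

Lemma sum_expr_ballot_le0 m : sg < 1 ->
  \sum_(k < m.+1) sg ^+ k * p m k <= p m 0 / (1 - sg) ^+ 2.
Proof.
move=> sg1'; rewrite ler_pdivlMr ?exprn_gt0 ?subr_gt0//.
apply: (@le_trans _ _ (p m 0 * ((1 - sg) ^+ 2 * \sum_(k < m.+1) k.+1%:R * sg ^+ k))).
  rewrite [leRHS]mulrCA [leLHS]mulrC ler_wpM2l ?sqr_ge0// mulr_sumr.
  apply: ler_sum => k _; rewrite mulrC mulrA ler_wpM2r ?exprn_ge0 ?(ltW sg0)//.
  by rewrite [leRHS]mulrC ballot_le.
by rewrite ler_piMr ?ballot_ge0// sum_succ_expr_le// (ltW sg0).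
Qed.

End Bounds.

(** * Comparison with Gamma quotients *)

(** Monotonicity reduces the claim to y = 1, where with P = (1/2)_(m+1) it reads 2P / (m+1)! <= 2 m!
    / (pi P), which is Wallis' inequality. *)
Lemma hypF_half_le (R : realType) (y : R) m : 0 < y -> y <= 1 ->
  hypF R (1 / 2) 2 m y <= 2 / Num.sqrt (pi * y) * (Gamma (m%:R + 1) / Gamma (m%:R + 3 / 2)).
Proof.
move=> y0 y1; have p1 := pi_gt0 R.
have s0 : 0 < Num.sqrt y by rewrite sqrtr_gt0.
have s1 : Num.sqrt y <= 1 by rewrite -sqrtr1 ler_wsqrtr.
have S0 : 0 < Num.sqrt pi :> R by rewrite sqrtr_gt0.
have c : 3%:R / 2 <= 2 :> R by lra.
have := expr_hypF_le R 2 (Num.sqrt y) 0 m c (ltW s0) s1.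
rewrite expr1 (sqr_sqrtr (ltW y0)) hypF_at1//.
have -> : 2 - 1 / 2 = 3 / 2 :> R by field.
rewrite pochhammer3half pochhammer2 Gamma_nat Gamma_nat_half sqrtrM ?pi_ge0//.
set P := pochhammer _ _; have P0 : 0 < P by apply: pochhammer_gt0; rewrite divr_gt0.
have W := pochhammer_half_sqr_le R m; rewrite -/P in W.
have f0 k : 0 < k`!%:R :> R by rewrite ltr0n fact_gt0.
move=> H; rewrite -(ler_pM2l s0); apply: (le_trans H).
have -> : Num.sqrt y * (2 / (Num.sqrt pi * Num.sqrt y) * (m`!%:R / (P * Num.sqrt pi))) =
    2 * m`!%:R / (pi * P).
  rewrite -[pi in RHS]sqr_sqrtr ?pi_ge0//.
  by field; rewrite !lt0r_neq0.
rewrite ler_pdivrMr// mulrAC ler_pdivlMr ?mulr_gt0//.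
by rewrite -!mulrA ler_pM2l// mulrCA -expr2.
Qed.

Lemma hypF_3half_le (R : realType) (y : R) m : 0 < y -> y <= 1 ->
  hypF R (3 / 2) 3 m y <=
  4 / (Num.sqrt pi * y `^ (3 / 2)) * (Gamma (m%:R + 1) / Gamma (m%:R + 5 / 2)).
Proof.
move=> y0 y1; have p1 := pi_gt0 R.
have s0 : 0 < Num.sqrt y by rewrite sqrtr_gt0.
have s1 : Num.sqrt y <= 1 by rewrite -sqrtr1 ler_wsqrtr.
have S0 : 0 < Num.sqrt pi :> R by rewrite sqrtr_gt0.
have c : 5%:R / 2 <= 3 :> R by lra.
have := expr_hypF_le R 3 (Num.sqrt y) 2 m c (ltW s0) s1.
rewrite (sqr_sqrtr (ltW y0)) hypF_at1//.
have -> : y `^ (3 / 2) = Num.sqrt y ^+ 3.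
  by rewrite mulrC powRrM powR12_sqrt ?ltW// powR_mulrn// ltW.
have -> : 3 - 3 / 2 = 3 / 2 :> R by field.
have -> : m%:R + 5 / 2 = m.+1%:R + 3 / 2 :> R by rewrite -natr1; field.
rewrite pochhammer3half pochhammer3 Gamma_nat Gamma_nat_half (pochhammerSr _ _ m.+1).
set P := pochhammer _ _; have P0 : 0 < P by apply: pochhammer_gt0; rewrite divr_gt0.
have W := pochhammer_half_sqr_le R m; rewrite -/P in W.
have f0 k : 0 < k`!%:R :> R by rewrite ltr0n fact_gt0.
set z := Num.sqrt y ^+ 3; have z0 : 0 < z by rewrite exprn_gt0.
set u := 1 / 2 + m.+1%:R; have u0 : 0 < u by rewrite addr_gt0 ?divr_gt0.
move=> H; rewrite -(ler_pM2l z0); apply: (le_trans H).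
have -> : z * (4 / (Num.sqrt pi * z) * (m`!%:R / (P * u * Num.sqrt pi))) =
    4 * m`!%:R / (pi * P * u).
  rewrite -[pi in RHS]sqr_sqrtr ?pi_ge0//.
  by field; rewrite !lt0r_neq0.
rewrite factS natrM.
have -> : 2 * P / (m.+2%:R * (m.+1)`!%:R / 2) = 4 * P / (m.+2%:R * (m.+1)`!%:R).
  by field; rewrite !lt0r_neq0.
rewrite ler_pdivrMr ?mulr_gt0// mulrAC ler_pdivlMr ?mulr_gt0//.
(* What remains is Wallis' inequality multiplied by m + 3/2 <= m + 2. *)
have um : u <= m.+2%:R by rewrite /u -(natr1 m.+1); lra.
have := ler_pM (mulr_ge0 (ltW p1) (sqr_ge0 P)) (ltW u0) W um.
rewrite -(ler_pM2l (_ : 0 < 4))// => {}H.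
apply: le_trans (le_trans _ H) _; rewrite le_eqVlt; apply/orP; left; apply/eqP; ring.
Qed.

Theorem corollary9 (R : realType) (ell alpha : R)
    (ell_gt0 : 0 < ell) (ell_le1 : ell <= 1)
    (alpha_gt0 : 0 < alpha) (alpha_le1 : alpha <= 1) :
  let sigma : R := Num.sqrt ell in
  let ella : R := 1 - alpha + alpha * ell in
  let sa : R := (1 - alpha + alpha * sigma) ^+ 2 in
  let eta : R := 4 * alpha * (1 - alpha) * sigma / sa in
  let Rm := fun m : nat => coef ell alpha m m.+1 / alpha in
  (forall m : nat, Rm m <= ella ^+ m) /\
  (alpha < 1 -> forall m : nat,
    [/\ Rm m <= (1 - ell) * ella ^+ m
                + sigma * hyp2F1 (1 / 2) (- m%:R) 2 eta * sa ^+ m,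
        Rm m <= (1 - ell) * ella ^+ m
                + 2 * sigma / Num.sqrt (pi * eta)
                  * (Gamma (m%:R + 1) / Gamma (m%:R + 3 / 2)) * sa ^+ m
      & ((Rm m)%:E <=
          if (ell == 1)%R then +oo
          else ((1 - ell) * ella ^+ m
                + 4 * ell / (Num.sqrt pi * eta `^ (3 / 2) * (1 - sigma) ^+ 2)
                  * (Gamma (m%:R + 1) / Gamma (m%:R + 5 / 2)) * sa ^+ m)%R%:E)%E]).
Proof.
move=> sigma ella sa eta Rm; split.
  by move=> m; exact: coef_le_expr.
move=> alpha_lt1 m.
have be0 : 0 < 1 - alpha by rewrite subr_gt0.
have sigma0 : 0 < sigma by rewrite sqrtr_gt0.
have t0 : 0 < alpha * sigma by rewrite mulr_gt0.
have bt0 : 0 < 1 - alpha + alpha * sigma by rewrite addr_gt0.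
have btn0 : 1 - alpha + alpha * sigma != 0 by rewrite lt0r_neq0.
have sa0 : 0 < sa by rewrite exprn_gt0.
have etaE : 4 * (1 - alpha) * (alpha * sigma) / (1 - alpha + alpha * sigma) ^+ 2 = eta.
  by rewrite /eta /sa; congr (_ / _); ring.
have eta0 : 0 < eta by rewrite -etaE !mulr_gt0// invr_gt0.
(* Here sa (1 - eta) = (be - t)^2 with be = 1 - alpha and t = alpha sigma. *)
have eta1 : eta <= 1.
  rewrite /eta ler_pdivrMr// mul1r -subr_ge0.
  rewrite (_ : _ - _ = (1 - alpha - alpha * sigma) ^+ 2) ?sqr_ge0//.
  by rewrite /sa; ring.
have bound1 : Rm m <= (1 - ell) * ella ^+ m + sigma * hypF R (1 / 2) 2 m eta * sa ^+ m.
  rewrite /Rm coef_sum_ballot// lerD2l.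
  apply: (le_trans (sum_expr_ballot_le _ _ _ _ _ _ _ _)) => //.
  by rewrite sum_ballot_hypF// etaE -/sa (mulrC (sa ^+ m)) mulrA.
split.
- by rewrite hyp2F1_oppn.
- apply: (le_trans bound1); rewrite lerD2l; apply: ler_wpM2r; first exact: (exprn_ge0 m (ltW sa0)).
  rewrite (mulrC 2) -2!mulrA; apply: (ler_wpM2l (ltW sigma0)); rewrite mulrA.
  exact: hypF_half_le.
- case: eqVneq => [_|elln1]; first by rewrite leey.
  have sigma1 : sigma < 1.
    by rewrite -sqrtr1 ltr_sqrt// lt_neqAle elln1.
  rewrite lee_fin /Rm coef_sum_ballot// lerD2l.
  have s2 : 0 < (1 - sigma) ^+ 2 by rewrite exprn_gt0// subr_gt0.
  (* The third bound does not pass through [bound1]: it keeps the decay of sigma^k and compares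
     every entry with the one at k = 0. *)
  apply: (@le_trans _ _ (ell * (ballot R (1 - alpha) (alpha * sigma) m 0 / (1 - sigma) ^+ 2))).
    by rewrite ler_wpM2l ?(ltW ell_gt0)// sum_expr_ballot_le0.
  rewrite ballotn0_hypF// etaE -/sa.
  have H := hypF_3half_le R eta m eta0 eta1.
  have K0 : 0 <= ell * sa ^+ m / (1 - sigma) ^+ 2.
    by rewrite divr_ge0 ?(ltW s2)// mulr_ge0 ?exprn_ge0 ?ltW.
  have := ler_wpM2l K0 H.
  set h := hypF _ _ _ _ _; set g := Gamma _ / Gamma _; set z := eta `^ _.
  have z0 : z != 0 by rewrite lt0r_neq0// powR_gt0.
  have p0 : Num.sqrt pi != 0 :> R by rewrite lt0r_neq0// sqrtr_gt0 pi_gt0.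
  have q0 : 1 - sigma != 0 by rewrite subr_eq0 eq_sym lt_eqF.
  have -> : ell * (sa ^+ m * h / (1 - sigma) ^+ 2) = ell * sa ^+ m / (1 - sigma) ^+ 2 * h.
    by field.
  by move/le_trans; apply; rewrite le_eqVlt; apply/orP; left; apply/eqP; field; rewrite q0 z0 p0.
Qed.
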